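(* Let $P$ be a monoid, $H$ a non-zero subgroup of $\mathcal{G}(P)$, $\mathbf{q}:\mathcal{G}(P)\to\mathcal{G}(P)/H$ the quotient map, and $\Gamma$ a $P/H$-graph, where $P/H$ denotes the monoid $\mathbf{q}(P)$. Then $\mathbf{q}^*\Gamma$ is a periodic $P$-graph.
   Context: All monoids are finitely generated, cancellative and abelian; $P$ is embedded in its Grothendieck group $\mathcal{G}(P)$ and is also regarded as a category with one object. A $P$-graph is a countable small category $\Lambda$ (identified with its set of morphisms) with a functor $d:\Lambda\to P$ satisfying the factorization property: whenever $d(\xi)=p+q$ there are unique $\eta,\zeta\in\Lambda$ with $d(\eta)=p$, $d(\zeta)=q$, $\xi=\eta\zeta$. $\Lambda^p=d^{-1}(p)$, $\Lambda^0$ is the vertex set, $r,s:\Lambda\to\Lambda^0$ are the range and source maps. All $P$-graphs are assumed row-finite and source-free: $0<|\{\xi\in\Lambda^p:r(\xi)=v\}|<\infty$ for all $v\in\Lambda^0$, $p\in P$. $\Omega_P=\{(p,q)\in P\times P: q-p\in P\}$ is the $P$-graph with $d(p,q)=q-p$, $s(p,q)=q$, $r(p,q)=p$. An infinite path of $\Lambda$ is a degree-preserving functor $x:\Omega_P\to\Lambda$; $\Lambda^\infty$ is the set of these, and $v\Lambda^\infty$ the set of those with range $x(0,0)=v$. For $p\in P$, $\sigma^p(x)(q,r)=x(p+q,p+r)$. An infinite path $x$ is periodic if $\sigma^p(x)=\sigma^q(x)$ for some $p\ne q$ in $P$. $\Lambda$ is periodic if there is $v\in\Lambda^0$ such that every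 $x\in v\Lambda^\infty$ is periodic. For a monoid homomorphism $f:P\to Q$ and a $Q$-graph $(\Gamma,d_\Gamma)$, the pullback $f^*\Gamma$ is the $P$-graph $\{(\lambda,p)\in\Gamma\times P: d_\Gamma(\lambda)=f(p)\}$ with $d(\lambda,p)=p$, $s(\lambda,p)=s(\lambda)$, $r(\lambda,p)=r(\lambda)$, and $(\mu,p)(\nu,q)=(\mu\nu,p+q)$ if $s(\mu)=r(\nu)$. Here $\mathbf{q}^*\Gamma$ is the pullback via the restriction $\mathbf{q}:P\to\mathbf{q}(P)$. *)

(* Defs.v *)
From HB Require Import structures.
From mathcomp Require Import all_boot all_algebra.
From mathcomp Require Import generic_quotient ring_quotient.
From mathcomp Require Import boolp classical_sets functions cardinality.

Set Implicit Arguments.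
Unset Strict Implicit.
Unset Printing Implicit Defensive.

Import GRing.Theory.
Local Open Scope ring_scope.
Local Open Scope quotient_scope.

HB.mixin Record isFgCancellative M of GRing.Nmodule M := {
  addcI : forall x : M, injective (+%R x);
  fin_gen : exists (n : nat) (g : 'I_n -> M),
    forall x : M, exists c : 'I_n -> nat, x = \sum_(i < n) g i *+ c i
}.

#[short(type="monoidFGCType")]
HB.structure Definition MonoidFGC :=
  { M of GRing.Nmodule M & isFgCancellative M }.

Section Grothendieck.
Variable P : monoidFGCType.

(** The pair [(a, b)] stands for [a - b]. Cancellativity makes this relation
    transitive. *)
Definition groth_rel (a b : P * P) : bool := a.1 + b.2 == b.1 + a.2.

Lemma groth_rel_equiv : equiv_class_of groth_rel.
Proof.
split=> [a|a b|b a c]; rewrite /groth_rel; [exact: eqxx|exact: eq_sym|].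
move=> /eqP ab /eqP bc; apply/eqP/(@addcI _ b.2).
by rewrite addrCA addrA ab -addrA [a.2 + _]addrC addrA bc addrAC addrC addrA.
Qed.

Canonical groth_equiv := EquivRelPack groth_rel_equiv.
Canonical groth_encModRel := defaultEncModRel groth_rel.

Definition groth := {eq_quot groth_rel}.
HB.instance Definition _ : EqQuotient _ groth_rel groth := EqQuotient.on groth.
HB.instance Definition _ := Choice.on groth.

Definition groth_zero : groth := \pi_groth (0, 0).
Definition groth_opp (x : groth) : groth :=
  \pi_groth ((repr x).2, (repr x).1).
Definition groth_add (x y : groth) : groth :=
  \pi_groth ((repr x).1 + (repr y).1, (repr x).2 + (repr y).2).

Lemma groth_piP (a b : P * P) :
  reflect (a.1 + b.2 = b.1 + a.2) (\pi_groth a == \pi_groth b).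
Proof. by rewrite eqmodE; apply: eqP. Qed.

Lemma groth_repr (a : P * P) :
  (repr (\pi_groth a)).1 + a.2 = a.1 + (repr (\pi_groth a)).2.
Proof. by apply/groth_piP; rewrite reprK. Qed.

Lemma groth_addE (a b : P * P) :
  groth_add (\pi a) (\pi b) = \pi_groth (a.1 + b.1, a.2 + b.2).
Proof. by apply/eqP/groth_piP; rewrite /= addrACA !groth_repr addrACA. Qed.

Lemma groth_oppE (a : P * P) : groth_opp (\pi a) = \pi_groth (a.2, a.1).
Proof.
by apply/eqP/groth_piP; rewrite /= addrC -groth_repr addrC.
Qed.

Lemma groth_addA : associative groth_add.
Proof.
elim/quotW=> a; elim/quotW=> b; elim/quotW=> c.
by rewrite !groth_addE /= !addrA.
Qed.

Lemma groth_addC : commutative groth_add.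
Proof.
elim/quotW=> a; elim/quotW=> b.
by rewrite !groth_addE addrC [a.2 + _]addrC.
Qed.

Lemma groth_add0 : left_id groth_zero groth_add.
Proof. by elim/quotW=> a; rewrite groth_addE /= !add0r; case: a. Qed.

Lemma groth_addN : left_inverse groth_zero groth_opp groth_add.
Proof.
elim/quotW=> a; rewrite groth_oppE groth_addE.
by apply/eqP/groth_piP; rewrite /= addr0 add0r addrC.
Qed.

HB.instance Definition _ := GRing.isZmodule.Build groth
  groth_addA groth_addC groth_add0 groth_addN.

Definition groth_in (p : P) : groth := \pi_groth (p, 0).

Lemma groth_in_is_additive : GRing.nmod_morphism groth_in.
Proof.
split=> // p q; rewrite [RHS]groth_addE /=.
by congr (\pi_groth (_, _)); rewrite addr0.
Qed.
HB.instance Definition _ :=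
  GRing.isNmodMorphism.Build P groth groth_in groth_in_is_additive.

Lemma groth_in_inj : injective groth_in.
Proof. by move=> p q /eqP/groth_piP; rewrite /= !addr0. Qed.

End Grothendieck.

Section QuotientMonoid.
Variables (P : monoidFGCType) (H : zmodClosed (groth P)).

Definition quot_proj (x : groth P) : Quotient.quot H :=
  \pi_(Quotient.quot H) x.

Lemma quot_projD : {morph quot_proj : x y / x + y}.
Proof. by move=> x y; rewrite /quot_proj !piE. Qed.

Lemma quot_proj0 : quot_proj 0 = 0.
Proof. by rewrite /quot_proj !piE. Qed.

Definition quot_image : {pred Quotient.quot H} :=
  fun y => `[< exists p : P, y = quot_proj (groth_in p) >].

Lemma quot_image_closed : GRing.nmod_closed quot_image.
Proof.
split=> [|x y /asboolP[p ->] /asboolP[q ->]]; apply/asboolP.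
  by exists 0; rewrite raddf0 quot_proj0.
by exists (p + q); rewrite raddfD quot_projD.
Qed.
HB.instance Definition _ :=
  GRing.isAddClosed.Build (Quotient.quot H) quot_image quot_image_closed.

(** [P / H], the image of [P] in [groth P / H]. *)
Definition quot_monoid : Type := {y : Quotient.quot H | quot_image y}.
HB.instance Definition _ := SubChoice.on quot_monoid.
HB.instance Definition _ :=
  GRing.SubChoice_isSubNmodule.Build (Quotient.quot H) quot_image quot_monoid
    quot_image_closed.

Lemma quot_monoid_in_subproof (p : P) : quot_image (quot_proj (groth_in p)).
Proof. by apply/asboolP; exists p. Qed.

Definition quot_monoid_in (p : P) : quot_monoid :=
  exist _ (quot_proj (groth_in p)) (quot_monoid_in_subproof p).

Lemma quot_monoid_in_is_additive : GRing.nmod_morphism quot_monoid_in.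
Proof.
split=> [|p q]; apply: val_inj => /=.
  by rewrite raddf0 quot_proj0.
by rewrite raddfD quot_projD.
Qed.
HB.instance Definition _ :=
  GRing.isNmodMorphism.Build P quot_monoid quot_monoid_in
    quot_monoid_in_is_additive.

Lemma quot_monoid_in_surj (y : quot_monoid) : exists p, y = quot_monoid_in p.
Proof.
by case: y => y hy; case/asboolP: (hy) => p e; exists p; apply: val_inj.
Qed.

Lemma quot_monoid_addcI (x : quot_monoid) : injective (+%R x).
Proof.
move=> y z /(congr1 val).
by rewrite !GRing.valD => /addrI/val_inj.
Qed.

Lemma quot_monoid_fin_gen : exists (n : nat) (g : 'I_n -> quot_monoid),
  forall x, exists c : 'I_n -> nat, x = \sum_(i < n) g i *+ c i.
Proof.
have [n [g gP]] := @fin_gen P; exists n, (quot_monoid_in \o g) => y.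
have [p ->] := quot_monoid_in_surj y; have [c ->] := gP p.
by exists c; rewrite raddf_sum; apply: eq_bigr => i _; rewrite raddfMn.
Qed.

HB.instance Definition _ :=
  isFgCancellative.Build quot_monoid quot_monoid_addcI quot_monoid_fin_gen.

End QuotientMonoid.

(** [@mcomp _ f g _] is the composite [f g], in the convention where the source
    of [f] is the range of [g]. In a [P]-graph the identities are exactly the
    morphisms of degree [0], so [obj] plays the role of the vertex set. *)
Record category := Category {
  obj : Type;
  mor : Type;
  src : mor -> obj;
  rng : mor -> obj;
  ident : obj -> mor;
  mcomp : forall f g : mor, src f = rng g -> mor;
  src_ident : forall v, src (ident v) = v;
  rng_ident : forall v, rng (ident v) = v;
  src_comp : forall f g (h : src f = rng g), src (mcomp h) = src g;
  rng_comp : forall f g (h : src f = rng g), rng (mcomp h) = rng f;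
  comp_id_l : forall v f (h : src (ident v) = rng f), mcomp h = f;
  comp_id_r : forall f v (h : src f = rng (ident v)), mcomp h = f;
  comp_assoc : forall f g k (hfg : src f = rng g) (hgk : src g = rng k)
      (h1 : src (mcomp hfg) = rng k) (h2 : src f = rng (mcomp hgk)),
    mcomp h1 = mcomp h2
}.

Arguments ident {c} _.
Arguments mcomp {c f g} _.

(** The last two fields say that [deg] is a functor to the one-object category
    [P]. *)
Record gradedCategory (P : monoidFGCType) := GradedCategory {
  gcat :> category;
  deg : mor gcat -> P;
  deg_ident : forall v, deg (ident v) = 0;
  deg_comp : forall f g (h : src f = rng g), deg (mcomp h) = deg f + deg g
}.

Arguments deg {P} {g} _ : rename.

Section PGraph.
Local Open Scope classical_set_scope.
Variables (P : monoidFGCType) (L : gradedCategory P).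

Definition factorization_property : Prop :=
  forall (xi : mor L) (p q : P), deg xi = p + q ->
  exists! ez : mor L * mor L,
    [/\ deg ez.1 = p, deg ez.2 = q &
        exists h : src ez.1 = rng ez.2, xi = mcomp h].

Definition row_finite : Prop :=
  forall (v : obj L) (p : P),
    finite_set [set xi : mor L | deg xi = p /\ rng xi = v].

Definition source_free : Prop :=
  forall (v : obj L) (p : P),
    [set xi : mor L | deg xi = p /\ rng xi = v] !=set0.

Definition is_pgraph : Prop :=
  [/\ countable [set: mor L], factorization_property,
      row_finite & source_free].

End PGraph.

Section Omega.
Variable P : monoidFGCType.

(** [q - p] is computed in the Grothendieck group and required to lie in [P]. *)
Definition omega_le (pq : P * P) : bool :=
  `[< exists r : P, groth_in pq.2 - groth_in pq.1 = groth_in r >].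

Lemma omega_leP (p q : P) : reflect (exists r, q = p + r) (omega_le (p, q)).
Proof.
apply: (iffP (asboolP _)) => /= -[r h]; exists r.
  by apply: groth_in_inj; rewrite raddfD /= -h addrC subrK.
by rewrite h raddfD /= addrC addKr.
Qed.

Definition omega_mor : Type := {pq : P * P | omega_le pq}.

Definition omega_deg (m : omega_mor) : P :=
  projT1 (cid (asboolW (valP m))).

Lemma omega_degP (m : omega_mor) :
  groth_in (val m).2 - groth_in (val m).1 = groth_in (omega_deg m).
Proof. exact: projT2 (cid (asboolW (valP m))). Qed.

Lemma omega_le_refl (p : P) : omega_le (p, p).
Proof. by apply/omega_leP; exists 0; rewrite addr0. Qed.

Lemma omega_le_trans (m n : omega_mor) :
  (val m).2 = (val n).1 -> omega_le ((val m).1, (val n).2).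
Proof.
case: m n => [[p q] /= /omega_leP[r ->]] [[q' s] /= /omega_leP[t ->]] /= <-.
by apply/omega_leP; exists (r + t); rewrite addrA.
Qed.

Definition omega_ident (p : P) : omega_mor := exist _ (p, p) (omega_le_refl p).

Definition omega_comp (m n : omega_mor) (h : (val m).2 = (val n).1) :
  omega_mor := exist _ ((val m).1, (val n).2) (omega_le_trans h).

Lemma omega_deg_ident (p : P) : omega_deg (omega_ident p) = 0.
Proof. by apply: groth_in_inj; rewrite -omega_degP subrr raddf0. Qed.

Lemma omega_deg_comp (m n : omega_mor) (h : (val m).2 = (val n).1) :
  omega_deg (omega_comp h) = omega_deg m + omega_deg n.
Proof.
apply: groth_in_inj; rewrite raddfD /= -!omega_degP /=.
by rewrite h [RHS]addrC addrA subrK.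
Qed.

Definition omega_cat : category.
Proof.
apply: (@Category P omega_mor (fun m => (val m).2) (fun m => (val m).1)
          omega_ident omega_comp) => //.
- by move=> v [[p q] ?] /= h; apply: val_inj; rewrite /= h.
- by move=> [[p q] ?] v /= h; apply: val_inj; rewrite /= -h.
- by move=> f g k *; apply: val_inj.
Defined.

Definition omega : gradedCategory P.
Proof.
apply: (@GradedCategory P omega_cat omega_deg).
- exact: omega_deg_ident.
- exact: omega_deg_comp.
Defined.

Lemma omega_le_shift (p : P) (m : omega_mor) :
  omega_le (p + (val m).1, p + (val m).2).
Proof.
case: m => [[q r] /= /omega_leP[t ->]].
by apply/omega_leP; exists t; rewrite addrA.
Qed.

Definition omega_shift (p : P) (m : omega_mor) : omega_mor :=
  exist _ (p + (val m).1, p + (val m).2) (omega_le_shift p m).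

Lemma omega_shift_deg (p : P) (m : omega_mor) :
  omega_deg (omega_shift p m) = omega_deg m.
Proof.
apply: groth_in_inj; rewrite -!omega_degP /= !(raddfD (@groth_in P)) /=.
by rewrite opprD addrACA subrr add0r.
Qed.

End Omega.

Record gradedFunctor (P : monoidFGCType) (C D : gradedCategory P) :=
  GradedFunctor {
  fobj : obj C -> obj D;
  fmor : mor C -> mor D;
  fmor_src : forall m, src (fmor m) = fobj (src m);
  fmor_rng : forall m, rng (fmor m) = fobj (rng m);
  fmor_ident : forall v, fmor (ident v) = ident (fobj v);
  fmor_comp : forall m n (h : src m = rng n)
      (h' : src (fmor m) = rng (fmor n)), fmor (mcomp h) = mcomp h';
  fmor_deg : forall m, deg (fmor m) = deg m
}.

Section Paths.
Variables (P : monoidFGCType) (L : gradedCategory P).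

Definition infinite_path : Type := gradedFunctor (omega P) L.

(** The vertex [x (0, 0)], since [fmor x (ident 0) = ident (fobj x 0)]. *)
Definition path_range (x : infinite_path) : obj L := fobj x (0 : P).

Definition shift (p : P) (x : infinite_path) : infinite_path.
Proof.
apply: (@GradedFunctor P (omega P) L
  (fun q : P => fobj x (p + q : P))
  (fun m : omega_mor P => fmor x (omega_shift p m))).
- by move=> m; rewrite fmor_src.
- by move=> m; rewrite fmor_rng.
- move=> v; rewrite -fmor_ident; congr (fmor x _).
  exact: val_inj.
- move=> m n h h'.
  have e : src (omega_shift p m : mor (omega P))
           = rng (omega_shift p n : mor (omega P)) := congr1 (+%R p) h.
  rewrite -(fmor_comp e); congr (fmor x _).
  exact: val_inj.
- by move=> m; rewrite fmor_deg; apply: omega_shift_deg.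
Defined.

Definition periodic_path (x : infinite_path) : Prop :=
  exists p q : P, p <> q /\ shift p x = shift q x.

Definition periodic : Prop :=
  exists v : obj L,
    forall x : infinite_path, path_range x = v -> periodic_path x.

End Paths.

Section Pullback.
Variables (P Q : monoidFGCType) (f : {additive P -> Q}).
Variable G : gradedCategory Q.

(** Vertices of the pullback are those of [G]: [(v, 0)] is identified with [v]. *)
Definition pullback_mor : Type := {lp : mor G * P | deg lp.1 == f lp.2}.

Lemma pullback_ident_subproof (v : obj G) : deg (ident v : mor G) == f 0.
Proof. by rewrite deg_ident raddf0. Qed.

Definition pullback_ident (v : obj G) : pullback_mor :=
  exist _ (ident v, 0) (pullback_ident_subproof v).

Lemma pullback_comp_subproof (m n : pullback_mor)
    (h : src (sval m).1 = rng (sval n).1) :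
  deg (mcomp h) == f ((sval m).2 + (sval n).2).
Proof.
by rewrite deg_comp raddfD (eqP (proj2_sig m)) (eqP (proj2_sig n)).
Qed.

Definition pullback_comp (m n : pullback_mor)
    (h : src (sval m).1 = rng (sval n).1) : pullback_mor :=
  exist _ (mcomp h, (sval m).2 + (sval n).2) (pullback_comp_subproof h).

Lemma pullback_mor_eq (m n : pullback_mor) :
  (sval m).1 = (sval n).1 -> (sval m).2 = (sval n).2 -> m = n.
Proof.
move: m n => [[a p] ha] [[b q] hb] /= eab epq; subst b q.
by congr exist; apply: bool_irrelevance.
Qed.

Definition pullback_cat : category.
Proof.
apply: (@Category (obj G) pullback_mor (fun m => src (sval m).1)
          (fun m => rng (sval m).1) pullback_ident pullback_comp).
- by move=> v; apply: src_ident.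
- by move=> v; apply: rng_ident.
- by move=> m n h; apply: src_comp.
- by move=> m n h; apply: rng_comp.
- move=> v m h; apply: pullback_mor_eq; first exact: comp_id_l.
  exact: add0r.
- move=> m v h; apply: pullback_mor_eq; first exact: comp_id_r.
  exact: addr0.
- move=> m n k hmn hnk h1 h2; apply: pullback_mor_eq; first exact: comp_assoc.
  by rewrite /= addrA.
Defined.

Definition pullback : gradedCategory P.
Proof.
by apply: (@GradedCategory P pullback_cat (fun m : pullback_mor => (sval m).2)).
Defined.

End Pullback.

(* Main.v *)
(** A non-zero element of [H] has the form [a - b] with [a <> b] in [P] and
    [q a = q b]. If [x] is an infinite path of the pullback, the paths
    [x(0, a + n)] and [x(0, b + n)] have equal components in [Gamma], since both
    are the initial segment of degree [q (a + n) = q (b + n)] of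
    [x(0, a + b + n)]. Their final segments [x(a + m, a + n)] and
    [x(b + m, b + n)] then agree for the same reason, so every infinite path
    satisfies [shift a x = shift b x]. *)
Require Import Defs.
From mathcomp Require Import all_boot all_algebra.
From mathcomp Require Import generic_quotient ring_quotient.
From mathcomp Require Import boolp classical_sets cardinality.

Set Implicit Arguments.
Unset Strict Implicit.
Unset Printing Implicit Defensive.
Local Open Scope ring_scope.

Import GRing.Theory.

(** Serves the countability of a pullback, whose morphisms carry an element of [P] as second
    coordinate. *)
Lemma monoidFGC_countable (P : monoidFGCType) : countable [set: P].
Proof.
have [n [g gP]] := @fin_gen P.
pose ev (c : {ffun 'I_n -> nat}) := \sum_(i < n) g i *+ c i.
apply: (@sub_countable _ _ _ (ev @` [set: {ffun 'I_n -> nat}])); last first.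
  exact: card_le_trans (card_image_le _ _) (countableP _).
apply: subset_card_le => p _; have [c ->] := gP p.
by exists (finfun c) => //; apply: eq_bigr => i _; rewrite ffunE.
Qed.

Lemma factorization_uniq (P : monoidFGCType) (L : gradedCategory P)
    (fac : factorization_property L) (e z e' z' : mor L)
    (h : src e = rng z) (h' : src e' = rng z') :
  mcomp h = mcomp h' -> deg e = deg e' -> deg z = deg z' -> e = e' /\ z = z'.
Proof.
move=> hh' de dz; have [ez [_ ezU]] := fac _ _ _ (deg_comp h).
have E1 : ez = (e, z) by apply: ezU; split=> //; exists h.
have E2 : ez = (e', z') by apply: ezU; split=> //; exists h'.
by move: E2; rewrite E1 => -[-> ->].
Qed.

(** The object map is recovered from the morphism map through ranges of identities; the remaining
    fields are proofs. *)
Lemma gradedFunctor_eq (P : monoidFGCType) (C D : gradedCategory P)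
    (F G : gradedFunctor C D) :
  (forall m, fmor F m = fmor G m) -> F = G.
Proof.
move=> FG; have FGo : fobj F = fobj G.
  by apply/funext => v; rewrite -[LHS]rng_ident -fmor_ident FG fmor_ident rng_ident.
move/funext: FG FGo; case: F G => [Fo Fm ? ? ? ? ?] [Go Gm ? ? ? ? ?] /= em eo.
by subst Go Gm; f_equal; exact: Prop_irrelevance.
Qed.

Section Pullback.
Local Open Scope classical_set_scope.
Variables (P Q : monoidFGCType) (f : {additive P -> Q}) (G : gradedCategory Q).

Lemma pullback_pgraph : is_pgraph G -> is_pgraph (pullback f G).
Proof.
case=> /countable_injP[c cI] Gfac Gfin Gsrc; split.
- have /countable_injP[k kI] := monoidFGC_countable P.
  apply/countable_injP; exists (fun m => pickle (c (sval m).1, k (sval m).2)).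
  move=> m n _ _ /(pcan_inj pickleK)-[mn1 mn2].
  by apply: pullback_mor_eq; [apply: cI|apply: kI] => //; rewrite inE.
- move=> [[xi p'] dxi] p q /= e; subst p'; have dxi' := eqP dxi.
  (* Factor [xi] in [G] along [f p + f q], then tag the two factors with [p] and [q]. *)
  rewrite raddfD in dxi'.
  have [[e z] [[/= de dz [h xiE]] ezU]] := Gfac _ _ _ dxi'.
  pose e' : pullback_mor f G := exist _ (e, p) (introT eqP de).
  pose z' : pullback_mor f G := exist _ (z, q) (introT eqP dz).
  exists (e', z'); split=> /=.
    by split=> //; exists h; apply: pullback_mor_eq.
  move=> [[[e1 p1] /= d1] [[z1 q1] /= d2]] [/= ? ? [k /(congr1 sval) /= [xiE1 _]]].
  subst p1 q1.
  have [ee zz] : (e, z) = (e1, z1).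
    by apply: ezU; split; [exact/eqP|exact/eqP|exists k].
  by congr pair; apply: pullback_mor_eq.
- move=> v p.
  have svalI : injective (sval : pullback_mor f G -> mor G * P).
    by move=> m n mn; apply: pullback_mor_eq; rewrite mn.
  (* [sval] embeds the morphisms of degree [p] with range [v] into this finite product. *)
  have := finite_setX (Gfin v (f p)) (finite_set1 p).
  move/(finite_preimage (in2W svalI)); apply: sub_finite_set => m [/= dm rm].
  by split=> //=; split=> //; rewrite -dm; exact/eqP/(svalP m).
- move=> v p; have [xi [dxi rxi]] := Gsrc v (f p).
  by exists (exist _ (xi, p) (introT eqP dxi)).
Qed.

Lemma pullback_shift (fac : factorization_property G) (a b : P)
    (x : infinite_path (pullback f G)) : f a = f b -> shift a x = shift b x.
Proof.
move=> fab.
have le0 p : omega_le (0 : P, p) by apply/omega_leP; exists p; rewrite add0r.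
pose pre p : mor (omega P) := exist _ (0, p) (le0 p).
pose y (m : mor (omega P)) : mor G := (sval (fmor x m)).1.
have degy m : deg (y m) = f (omega_deg m).
  by rewrite (eqP (svalP (fmor x m))) -[omega_deg m](fmor_deg x m).
(* In [omega P], the morphism (0, q) is (0, p) followed by (p, q), where [m] is (p, q); apply [x]
   and project to [G]. *)
have yE (m : mor (omega P)) : exists h : src (y (pre (rng m))) = rng (y m),
    y (pre (src m)) = mcomp h.
  have h0 : src (pre (rng m)) = rng m by [].
  have h : src (fmor x (pre (rng m))) = rng (fmor x m).
    by rewrite fmor_src fmor_rng h0.
  exists h; have /(congr1 (fun m => (sval m).1)) /= <- := fmor_comp h0 h.
  by congr (y _); apply: val_inj.
(* Only the images of the degrees under [f] need to agree, since factorizations are compared in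
   [G]. *)
have y_uniq (m m' : mor (omega P)) : y (pre (src m)) = y (pre (src m')) ->
    f (rng m) = f (rng m') -> f (omega_deg m) = f (omega_deg m') ->
    y (pre (rng m)) = y (pre (rng m')) /\ y m = y m'.
  have [h hE] := yE m; have [h' hE'] := yE m'; rewrite hE hE' => hh' fr fd.
  apply: (factorization_uniq fac hh'); rewrite !degy //.
  have deg_pre p : omega_deg (pre p) = p.
    by apply: groth_in_inj; rewrite -omega_degP /= (raddf0 (@groth_in P)) subr0.
  by rewrite !deg_pre.
have le_add p q : omega_le (p, p + q : P) by apply/omega_leP; exists q.
pose ext p q : mor (omega P) := exist _ (p, p + q) (le_add p q).
have deg_ext p q : omega_deg (ext p q) = q.
  by apply: groth_in_inj; rewrite -omega_degP /= raddfD addrC addKr.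
(* Both extensions end at [a + b + n]. *)
have y_pre n : y (pre (a + n)) = y (pre (b + n)).
  apply: (y_uniq (ext (a + n) b) (ext (b + n) a) _ _ _).1 => /=.
  - by congr (y (pre _)); rewrite addrC addrA addrAC [b + n + a]addrC addrA addrAC.
  - by rewrite !raddfD fab.
  - by rewrite !deg_ext.
apply: gradedFunctor_eq => m; apply: pullback_mor_eq => /=.
  apply: (y_uniq (omega_shift a m) (omega_shift b m) (y_pre _) _ _).2 => /=.
    by rewrite !raddfD fab.
  by rewrite !omega_shift_deg.
(* The [P]-coordinate is the degree in the pullback, which shifting preserves. *)
have d2 c : (sval (fmor x (omega_shift c m))).2 = omega_deg m.
  by rewrite -(omega_shift_deg c m) -[RHS](fmor_deg x).
by rewrite !d2.
Qed.

End Pullback.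

Lemma quot_monoid_in_eq (P : monoidFGCType) (H : zmodClosed (groth P))
    (a b : P) :
  groth_in a - groth_in b \in H -> quot_monoid_in H a = quot_monoid_in H b.
Proof.
move=> abH; apply: val_inj; apply/eqP.
by rewrite /= /quot_proj -Quotient.idealrBE.
Qed.

Lemma groth_surj (P : monoidFGCType) (h : groth P) :
  exists a b : P, h = groth_in a - groth_in b.
Proof.
elim/quotW: h => -[a b]; exists a, b.
by rewrite [- _]groth_oppE [RHS]groth_addE /= addr0 add0r.
Qed.

(* Gamma is non-empty: the empty category has no vertex, hence is not periodic. *)
Theorem theorem4p11 (P : monoidFGCType) (H : zmodClosed (groth P))
    (H_nonzero : exists2 h : groth P, h \in H & h != 0)
    (Gamma : gradedCategory (quot_monoid H))
    (Gamma_pgraph : is_pgraph Gamma)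
    (Gamma_nonempty : inhabited (obj Gamma)) :
  is_pgraph (pullback (@quot_monoid_in P H) Gamma) /\
  periodic (pullback (@quot_monoid_in P H) Gamma).
Proof.
split; first exact: pullback_pgraph.
have [h hH h0] := H_nonzero; have [a [b hE]] := groth_surj h.
(* The non-zero element of [H] makes the two shifts distinct. *)
have ab : a <> b by move=> ab; move: h0; rewrite hE ab subrr eqxx.
have qab : quot_monoid_in H a = quot_monoid_in H b.
  by apply: quot_monoid_in_eq; rewrite -hE.
have [v] := Gamma_nonempty; exists v => x _; exists a, b; split=> //.
by have [_ fac _ _] := Gamma_pgraph; exact: pullback_shift.
Qed.
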